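(* Let $b\in\mathbb{R}^n\setminus\mathbb{Z}^n$. Then $$G_b=\operatorname{cl}(\operatorname{conv}(I_b))=\operatorname{conv}(I_b)+\mathbb{R}^{(\mathbb{R}^n)}_+ .$$
   Context: $\mathbb{R}^{(\mathbb{R}^n)}$ is the real vector space of functions $\mathbb{R}^n\to\mathbb{R}$ with finite support, and $\mathbb{R}^{(\mathbb{R}^n)}_+$ is the subset of its nonnegative functions. $M_b$ is the set of all pairs $(s,y)$ of finite-support functions $s:\mathbb{R}^n\to\mathbb{R}_+$, $y:\mathbb{R}^n\to\mathbb{Z}_+$ such that $\sum_{r\in\mathbb{R}^n} r\,s(r)+\sum_{p\in\mathbb{R}^n}p\,y(p)\in b+\mathbb{Z}^n$. $I_b=\{y\in\mathbb{R}^{(\mathbb{R}^n)}:(0,y)\in M_b\}$. For $\psi,\pi:\mathbb{R}^n\to\mathbb{R}$ and $\alpha\in\mathbb{R}$ let $H_{\psi,\pi,\alpha}=\{(s,y)\in\mathbb{R}^{(\mathbb{R}^n)}\times\mathbb{R}^{(\mathbb{R}^n)}:\sum_{r}\psi(r)s(r)+\sum_{p}\pi(p)y(p)\ge\alpha\}$. The tuple $(\psi,\pi,\alpha)$ is a valid tuple for $M_b$ if $M_b\subseteq H_{\psi,\pi,\alpha}$; by positive rescaling it is assumed that $\alpha\in\{-1,0,1\}$. $Q_b$ denotes the intersection of $\mathbb{R}^{(\mathbb{R}^n)}_+\times\mathbb{R}^{(\mathbb{R}^n)}_+$ with all $H_{\psi,\pi,\alpha}$ for $(\psi,\pi,\alpha)$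 a valid tuple for $M_b$, and $G_b=\{y\in\mathbb{R}^{(\mathbb{R}^n)}:(0,y)\in Q_b\}$. $\operatorname{conv}$ is the convex hull, and $\operatorname{cl}$ is the closure in $\mathbb{R}^{(\mathbb{R}^n)}$ in the topology induced by the norm $|y|_*=|y(0)|+\sum_{p\in\mathbb{R}^n}\|p\||y(p)|$, where $\|\cdot\|$ is the usual (Euclidean) norm on $\mathbb{R}^n$. *)

(* Defs.v *)
From HB Require Import structures.
From mathcomp Require Import all_boot all_order all_algebra.
From mathcomp Require Import finmap.
From mathcomp Require Import all_classical all_reals all_analysis.

Set Implicit Arguments.
Unset Strict Implicit.
Unset Printing Implicit Defensive.

Import Order.TTheory GRing.Theory Num.Theory.
Import numFieldNormedType.Exports.

Local Open Scope classical_set_scope.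
Local Open Scope ring_scope.

Section FinSuppType.
Context (R : realType) (n : nat).

Definition fin_supp : {pred 'rV[R]_n -> R} :=
  [pred f : 'rV[R]_n -> R | `[< finite_set [set x | f x != 0] >]].

(* finitely supported functions R^n -> R, as a subtype of 'rV[R]_n -> R, from
   which it inherits its pointwise vector space structure *)
Record finSupp := FinSupp {
  finSupp_val :> 'rV[R]_n -> R;
  _ : finSupp_val \in fin_supp }.

HB.instance Definition _ := [isSub for finSupp_val].
HB.instance Definition _ := [Choice of finSupp by <:].

Lemma fin_suppP (f : 'rV[R]_n -> R) :
  reflect (finite_set [set x | f x != 0]) (f \in fin_supp).
Proof. by rewrite inE; exact: asboolP. Qed.

Lemma fin_supp_submod_closed : submod_closed fin_supp.
Proof.
split=> [|a f g /fin_suppP Ff /fin_suppP Fg]; apply/fin_suppP.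
  rewrite (_ : [set _ | _] = set0)//; apply/seteqP; split=> // x /=.
  by rewrite [X in X != 0](_ : _ = 0)// eqxx.
apply: (@sub_finite_set _ _ ([set x | f x != 0] `|` [set x | g x != 0])).
  move=> x /=; have [fx0|fx0] := eqVneq (f x) 0; last by left.
  have [gx0|gx0] := eqVneq (g x) 0; last by right.
  by rewrite [X in X != 0](_ : _ = a * f x + g x)// fx0 gx0 mulr0 addr0 eqxx.
by rewrite finite_setU.
Qed.

HB.instance Definition _ :=
  GRing.isSubmodClosed.Build R ('rV[R]_n -> R) fin_supp fin_supp_submod_closed.
HB.instance Definition _ := [SubChoice_isSubLmodule of finSupp by <:].

Lemma finSupp_finite (f : finSupp) : finite_set [set x | f x != 0].
Proof. exact/fin_suppP/valP. Qed.

(* the Euclidean norm: the library norm on 'rV[R]_n is the max norm *)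
Definition enorm (p : 'rV[R]_n) : R := Num.sqrt (\sum_i p 0 i ^+ 2).

Lemma enorm_ge0 p : 0 <= enorm p. Proof. exact: sqrtr_ge0. Qed.

Lemma enorm_eq0 p : enorm p = 0 -> p = 0.
Proof.
have sq_ge0 : 0 <= \sum_i p 0 i ^+ 2 by apply: sumr_ge0 => i _; exact: sqr_ge0.
move=> /eqP; rewrite sqrtr_eq0 => le0.
have /eqP : \sum_i p 0 i ^+ 2 = 0 by apply/eqP; rewrite eq_le le0 sq_ge0.
rewrite psumr_eq0 => [/allP p0|i _]; last exact: sqr_ge0.
apply/rowP => i; rewrite mxE; apply/eqP.
by have := p0 i (mem_index_enum i); rewrite /= sqrf_eq0.
Qed.

Definition star_norm (y : finSupp) : R :=
  `|y 0| + \sum_(p \in [set: 'rV[R]_n]) enorm p * `|y p|.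

Lemma finite_mul_supp (F : 'rV[R]_n -> R) (y : finSupp) :
  finite_set [set p | F p * `|y p| != 0].
Proof.
apply: sub_finite_set (finSupp_finite y) => p /=.
by apply: contra_neq => ->; rewrite normr0 mulr0.
Qed.

Lemma fsumT_seq (F : 'rV[R]_n -> R) (D : set 'rV[R]_n) : finite_set D ->
  [set p | F p != 0] `<=` D ->
  \sum_(p \in [set: 'rV[R]_n]) F p = \sum_(p <- fset_set D) F p.
Proof.
move=> Dfin FD; apply: fsbigTE => p; rewrite in_fset_set// notin_setE => Dp.
by apply/eqP; apply/negPn/negP => /FD.
Qed.

Lemma star_normD x y : star_norm (x + y) <= star_norm x + star_norm y.
Proof.
pose D := [set p | x p != 0] `|` [set p | y p != 0].
have Dfin : finite_set D.
  by rewrite finite_setU; split; exact: finSupp_finite.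
have sumE (z : finSupp) : [set p | z p != 0] `<=` D ->
    \sum_(p \in [set: 'rV[R]_n]) enorm p * `|z p|
    = \sum_(p <- fset_set D) enorm p * `|z p|.
  move=> zD; apply: fsumT_seq => // p /= zp; apply: zD => /=.
  by apply: contra_neq zp => ->; rewrite normr0 mulr0.
rewrite /star_norm !sumE; last 3 first.
- by move=> p; right.
- by move=> p; left.
- move=> p /=; have [x0|] := eqVneq (x p) 0; last by left.
  have [y0|] := eqVneq (y p) 0; last by right.
  by rewrite [X in X != 0](_ : _ = x p + y p)// x0 y0 addr0 eqxx.
rewrite addrACA -big_split/=; apply: lerD; first exact: ler_normD.
apply: ler_sum => p _; rewrite -mulrDr ler_wpM2l ?enorm_ge0//.
exact: ler_normD.
Qed.

Lemma star_normZ (l : R) x : star_norm (l *: x) = `|l| * star_norm x.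
Proof.
rewrite /star_norm mulrDr; congr (_ + _); first exact: normrM.
rewrite mulr_fsumr; apply: eq_fsbigr => p _.
by rewrite [X in `|X|](_ : _ = l * x p)// normrM mulrCA.
Qed.

Lemma star_norm_eq0 x : star_norm x = 0 -> x = 0.
Proof.
pose D := [set p | x p != 0].
have Dfin : finite_set D by exact: finSupp_finite.
rewrite /star_norm (@fsumT_seq _ D)//; last first.
  by move=> p /=; apply: contra_neq => ->; rewrite normr0 mulr0.
have ge0 p : 0 <= enorm p * `|x p| by rewrite mulr_ge0 ?enorm_ge0.
move=> /eqP; rewrite paddr_eq0 ?sumr_ge0// normr_eq0 => /andP[/eqP x0].
rewrite psumr_eq0// => /allP xD; apply/val_inj/funext => p /=.
rewrite [RHS](_ : _ = 0)//; apply/eqP/negPn/negP => xp.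
have /xD : p \in fset_set D by rewrite in_fset_set// mem_setE.
rewrite /= mulf_eq0 normr_eq0 (negbTE xp) orbF => /eqP/enorm_eq0 p0.
by rewrite p0 x0 eqxx in xp.
Qed.

(* star_norm is the canonical norm of finSupp, so that the library's closure on
   set (finSupp R n) is the closure in the topology it induces *)
HB.instance Definition _ :=
  Lmodule_isNormed.Build R finSupp star_normD star_normZ star_norm_eq0.

Lemma finSupp_normE (y : finSupp) : `|y| = star_norm y.
Proof. by []. Qed.

End FinSuppType.

Arguments finSupp : clear implicits.

Definition convex_hull (R : realType) (E : lmodType R) (A : set E) : set E :=
  smallest (@convex_set R E) A.

Section Relaxation.
Context (R : realType) (n : nat).
Implicit Types (b p r : 'rV[R]_n) (s y : finSupp R n).

(* Sums of the form \sum_(r \in setT) F r range over the support of F, which is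
   finite in all the uses below. *)

Definition int_lattice : set 'rV[R]_n :=
  [set z | forall i, z 0 i \is a Num.int].

Definition nonneg : set (finSupp R n) := [set y | forall p, 0 <= y p].

Definition M_ b : set (finSupp R n * finSupp R n) :=
  [set sy : finSupp R n * finSupp R n | [/\ nonneg sy.1,
                (forall p, sy.2 p \is a Num.nat) &
                exists2 z, int_lattice z &
                  \sum_(r \in [set: 'rV[R]_n]) sy.1 r *: r
                  + \sum_(p \in [set: 'rV[R]_n]) sy.2 p *: p = b + z]].

Definition I_ b : set (finSupp R n) := [set y | M_ b (0, y)].

Definition H_ (psi pi : 'rV[R]_n -> R) (alpha : R) :
    set (finSupp R n * finSupp R n) :=
  [set sy : finSupp R n * finSupp R n | alpha <= \sum_(r \in [set: 'rV[R]_n]) psi r * sy.1 r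
                     + \sum_(p \in [set: 'rV[R]_n]) pi p * sy.2 p].

(* alpha is normalized to -1, 0 or 1, as positive rescaling allows *)
Definition valid_tuple b (psi pi : 'rV[R]_n -> R) (alpha : R) : Prop :=
  alpha \in [:: -1; 0; 1] /\ M_ b `<=` H_ psi pi alpha.

Definition Q_ b : set (finSupp R n * finSupp R n) :=
  [set sy : finSupp R n * finSupp R n | [/\ nonneg sy.1, nonneg sy.2 &
                forall psi pi alpha,
                  valid_tuple b psi pi alpha -> H_ psi pi alpha sy]].

Definition G_ b : set (finSupp R n) := [set y | Q_ b (0, y)].

End Relaxation.

Arguments int_lattice : clear implicits.
Arguments nonneg : clear implicits.

(* Main.v *)
(* Let C = conv(I_b) + R_+.
   - C is contained in cl(conv(I_b)): by Dirichlet's theorem, some multiple N p of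
     each p is within epsilon of a lattice point z, and adding to an element of
     I_b the point p taken N times and the point z - N p once stays in I_b; the
     norm hardly charges the second summand.
   - cl(conv(I_b)) is contained in G_b: given y in the closure and a valid tuple
     (psi, pi, alpha), keep pi on the support of y and replace it elsewhere by a
     multiple of the norm (the mass off the support can be moved to s, along the
     coordinate axes). The new inequality holds on I_b, is continuous and has the
     same value at y.
   - G_b is contained in C: the elements of I_b supported on the finite support P
     of y are, by Dickson's lemma, dominated below by finitely many of them. If y
     is not in C, Farkas' lemma gives pi > 0 on P with pi x >= 1 on these elements
     and pi y < 1. Since pi > 0, only finitely many x supported on P have
     pi x < 1, and these miss b + Z^n by a positive distance; so pi, extended by a
     large multiple of the norm off P, and the same multiple as psi, form a valid
     tuple that y violates. *)
From HB Require Import structures.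
Require Import Defs.
From mathcomp Require Import all_boot all_order all_algebra.
From mathcomp Require Import finmap.
From mathcomp Require Import all_classical all_reals all_analysis.
From mathcomp Require Import lra ring.
Import Order.TTheory GRing.Theory Num.Theory.
Import numFieldNormedType.Exports.
Local Open Scope classical_set_scope.
Local Open Scope ring_scope.
Set Implicit Arguments.
Unset Strict Implicit.
Unset Printing Implicit Defensive.

(** * Dickson's lemma, Farkas' lemma, convex combinations and Diophantine approximation *)

Lemma dickson (T : choiceType) (J : eqType) (v : T -> J -> nat) (s : seq J)
    (A : set T) : exists F : set T, [/\ finite_set F, F `<=` A &
  forall a, A a -> exists2 f, F f & forall p, p \in s -> (v f p <= v a p)%N].
Proof.
elim: s A => [|p s IHs] A.
  have [[a Aa]|A0] := pselect (A !=set0); last first.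
    by exists set0; split=> // a Aa; case: A0; exists a.
  by exists [set a]; split=> // [_ ->//|a' _]; exists a.
have [F0 [F0fin F0A F0P]] := IHs A.
have [M hM] : exists M, forall f, F0 f -> (v f p <= M)%N.
  exists (\max_(f <- fset_set F0) v f p)%N => f F0f.
  by rewrite (@leq_bigmax_seq _ (enum_fset (fset_set F0)) xpredT (v^~ p))//
    in_fset_set ?inE.
have /choice[F hF] c := IHs (A `&` [set a | v a p = c]).
(* An element whose [p] entry is at least [M] lies above one of [F0]. The others fall into finitely
   many slices [v a p = c] with [c < M], where the induction hypothesis applies. *)
exists (F0 `|` \bigcup_(c in `I_M) F c); split.
- rewrite finite_setU; split=> //; apply: bigcup_finite => [|c _].
    exact: finite_II.
  by have [] := hF c.
- by move=> f [/F0A//|[c _ Fcf]]; have [_ /(_ _ Fcf)[]] := hF c.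
move=> a Aa; have [Mle|ltM] := leqP M (v a p).
  have [f F0f fa] := F0P a Aa; exists f; first by left.
  move=> q; rewrite inE => /orP[/eqP->|]; last exact: fa.
  exact: leq_trans (hM _ F0f) Mle.
have [_ FA /(_ a)[|f Ff fa]] := hF (v a p); first by split.
exists f; first by right; exists (v a p).
move=> q; rewrite inE => /orP[/eqP->|]; last exact: fa.
by have [_ ->] := FA _ Ff.
Qed.

(* Bartl's induction: if x satisfies the first constraints but not the last one,
   project everything onto the kernel of the last functional along x. *)
Lemma farkas (R : realFieldType) (W : lmodType R) (I : eqType)
    (a : I -> {scalar W}) (c : {scalar W}) (s : seq I) : uniq s ->
  (exists2 l : I -> R, (forall i, 0 <= l i) &
     forall w, c w = \sum_(i <- s) l i * a i w) \/
  (exists2 w, forall i, i \in s -> a i w <= 0 & 0 < c w).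
Proof.
elim: s a c => [|j s IHs] a c.
  move=> _; have [[w cw]|c0] := pselect (exists w, c w != 0); last first.
    left; exists (fun=> 0) => // w; rewrite big_nil.
    by apply/eqP/negPn/negP => cw; apply: c0; exists w.
  right; have [cw0|cw0|cw0] := ltgtP (c w) 0; last by rewrite cw0 eqxx in cw.
    by exists (- w) => //; rewrite linearN oppr_gt0.
  by exists w.
move=> /= /andP[js us].
have [[l l0 cE]|[x ax cx]] := IHs a c us.
  left; exists (fun i => if i == j then 0 else l i).
    by move=> i; case: ifP.
  move=> w; rewrite big_cons eqxx mul0r add0r cE !big_seq.
  by apply: eq_bigr => i si; case: eqP => // ij; rewrite -ij si in js.
have [ajx|ajx] := lerP (a j x) 0.
  by right; exists x => // i; rewrite inE => /orP[/eqP->|/ax].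
have [x1 [ajx1 ax1 cx1]] : exists x1, [/\ a j x1 = 1,
    forall i, i \in s -> a i x1 <= 0 & 0 < c x1].
  exists ((a j x)^-1 *: x); rewrite !linearZ/= mulVf ?gt_eqF//.
  rewrite mulr_gt0 ?invr_gt0//; split=> // i si.
  by rewrite linearZ/= pmulr_rle0 ?invr_gt0 ?ax.
pose pr w := w - a j w *: x1.
have prE (f : {scalar W}) w : f (pr w) = f w - a j w * f x1.
  by rewrite /pr linearB linearZ.
have lin_pr (f : {scalar W}) : scalar (f \o pr).
  move=> k u v; rewrite /= !prE !linearP/=; ring.
pose fp (f : {scalar W}) : {scalar W} :=
  HB.pack (f \o pr) (GRing.isLinear.Build _ _ _ _ _ (lin_pr f)).
have [[l l0 cE]|[w aw cw]] := IHs (fun i => fp (a i)) (fp c) us; last first.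
  right; exists (pr w) => // i; rewrite inE => /orP[/eqP->|/aw//].
  by rewrite prE ajx1 mulr1 subrr.
(* Substituting [w = pr w + a j w *: x1] leaves this factor on [a j]; it is nonnegative because
   [c x1 > 0] and each [a i x1 <= 0]. *)
left; exists (fun i => if i == j then c x1 - \sum_(i <- s) l i * a i x1 else l i).
  move=> i; case: ifP => // _; rewrite subr_ge0 (le_trans _ (ltW cx1))//.
  by rewrite big_seq sumr_le0// => k sk; rewrite mulr_ge0_le0 ?ax1.
move=> w; rewrite big_cons eqxx.
rewrite [X in _ + X](_ : _ = \sum_(i <- s) l i * a i w); last first.
  rewrite !big_seq; apply: eq_bigr => i si; case: eqP => // ij.
  by rewrite -ij si in js.
have := cE w; rewrite /= prE => /eqP; rewrite subr_eq => /eqP->.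
under eq_bigr do rewrite /= prE mulrBr mulrCA.
rewrite sumrB -mulr_sumr; ring.
Qed.

Lemma convex_setP (R : realFieldType) (E : lmodType R) (C : set E) :
  convex_set C <-> (forall x y (t : R), 0 <= t <= 1 -> C x -> C y ->
    C (t *: x + (1 - t) *: y)).
Proof.
split=> [convC x y t t01 Cx Cy|convC x y t]; last first.
  by rewrite !inE => Cx Cy; apply: convC => //; rewrite ge0 le1.
have itv_t : Itv.spec (@Itv.num_sem R) (Itv.Real `[0%Z, 1%Z]) t.
  by apply/and3P; split; rewrite /= ?num_real// bnd_simp; case/andP: t01.
by have := convC x y (Itv.mk itv_t); rewrite !inE; apply.
Qed.

Lemma sum_convex (R : realFieldType) (E : lmodType R) (C : set E)
    (I : eqType) (s : seq I) (l : I -> R) (f : I -> E) :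
  convex_set C -> (forall i, i \in s -> C (f i)) -> (forall i, 0 <= l i) ->
  \sum_(i <- s) l i = 1 -> C (\sum_(i <- s) l i *: f i).
Proof.
move=> convC Cf l0 l1.
(* For the induction, partial sums are normalized to total weight 1; the first alternative covers
   those of weight zero. *)
suff : \sum_(i <- s) l i = 0 /\ \sum_(i <- s) l i *: f i = 0 \/
    0 < \sum_(i <- s) l i /\
    C ((\sum_(i <- s) l i)^-1 *: (\sum_(i <- s) l i *: f i)).
  by rewrite l1 invr1 scale1r => -[[/eqP]|[]//]; rewrite oner_eq0.
elim: s Cf {l1} => [|i s IHs] Cf; first by left; rewrite !big_nil.
have Ci : C (f i) by apply: Cf; rewrite inE eqxx.
rewrite !big_cons; case: IHs => [j js|[-> ->]|[S0 CS]].
- by apply: Cf; rewrite inE js orbT.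
- rewrite !addr0; have := l0 i; rewrite le_eqVlt => /orP[/eqP<-|li0].
    by left; rewrite scale0r.
  by right; split=> //; rewrite scalerA mulVf ?gt_eqF// scale1r.
right; set S := (\sum_(j <- s) l j) in S0 CS *.
have L0 : 0 < l i + S by rewrite ltr_wpDl.
split=> //.
have -> : (l i + S)^-1 *: (l i *: f i + \sum_(j <- s) l j *: f j) =
    (l i / (l i + S)) *: f i +
    (1 - l i / (l i + S)) *: (S^-1 *: (\sum_(j <- s) l j *: f j)).
  rewrite !scalerA scalerDr scalerA mulrC; congr (_ + _ *: _).
  by field; rewrite !gt_eqF.
apply: ((convex_setP C).1 convC) => //; rewrite divr_ge0 ?(ltW L0)//=.
by rewrite ler_pdivrMr// mul1r lerDl ltW.
Qed.

(* Pigeonhole on the boxes of side 1/m containing the fractional parts of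
   [k *: p] for k <= m ^ n. *)
Lemma dirichlet (R : realType) (n : nat) (p : 'rV[R]_n) (e : R) : 0 < e ->
  exists N : nat, (0 < N)%N /\
    exists2 z, int_lattice R n z & forall i, `|(z - N%:R *: p) 0 i| < e.
Proof.
move=> e0.
pose m := (Num.truncn e^-1).+1.
have m0 : 0 < m%:R :> R by rewrite ltr0n.
have me : m%:R^-1 < e by rewrite invf_plt ?posrE// truncnS_gt.
pose fr k i : R := k%:R * p 0 i - (Num.floor (k%:R * p 0 i))%:~R.
have fr0 k i : 0 <= fr k i by rewrite subr_ge0 floor_le.
have fr1 k i : fr k i < 1.
  rewrite ltrBlDl -[X in _ + X]/1%:~R -intrD.
  by case/andP: (floor_itv (k%:R * p 0 i)).
have box k i : (Num.truncn (m%:R * fr k i) < m)%N.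
  rewrite -(ltr_nat R); apply: (@le_lt_trans _ _ (m%:R * fr k i)).
    by rewrite truncn_le mulr_ge0 ?ler0n.
  by rewrite gtr_pMr.
pose f (k : 'I_(m ^ n).+1) := [ffun i : 'I_n => Ordinal (box k i)].
have /injectivePn[k [l kl fkl]] : ~~ injectiveb f.
  apply/negP => /injectiveP /leq_card.
  by rewrite card_ffun !card_ord ltnn.
wlog lk : k l kl fkl / (l < k)%N.
  move=> H; have : k != l :> nat by [].
  by rewrite neq_ltn => /orP[] h; [apply: (H l k)|apply: (H k l)]; rewrite // eq_sym.
exists (k - l)%N; split; first by rewrite subn_gt0.
(* With this [z], the error is a difference of two fractional parts lying in the same box. *)
exists (\row_i ((Num.floor (k%:R * p 0 i))%:~R - (Num.floor (l%:R * p 0 i))%:~R)).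
  by move=> i; rewrite mxE rpredB ?intr_int.
move=> i; apply: lt_trans me; rewrite !mxE natrB; last exact: ltnW.
rewrite [X in `|X|](_ : _ = fr l i - fr k i); last by rewrite /fr; ring.
have /(congr1 val)/= : f k i = f l i by rewrite fkl.
rewrite !ffunE /= => tkl.
have := truncn_itv (mulr_ge0 (ltW m0) (fr0 k i)).
have := truncn_itv (mulr_ge0 (ltW m0) (fr0 l i)).
rewrite tkl -natr1; set t := _%:R => /andP[l1 l2] /andP[k1 k2].
rewrite -[_^-1]mul1r ltr_pdivlMr// -[X in _ * X]gtr0_norm// -normrM.
by rewrite ltr_norml; apply/andP; split; lra.
Qed.

Lemma nonint_dist (R : realType) (x : R) : x \isn't a Num.int ->
  exists2 d, 0 < d & forall m, m \is a Num.int -> d <= `|x - m|.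
Proof.
move=> xint; have /andP[le_x x_lt] := floor_itv x.
rewrite intrD in x_lt; set t := (Num.floor x)%:~R in le_x x_lt.
have lt_x : 0 < x - t by rewrite subr_gt0 lt_neqAle le_x andbT -intrEfloor.
exists (Num.min (x - t) (t + 1 - x)); first by rewrite lt_min lt_x subr_gt0.
move=> _ /intrP[m ->]; rewrite ge_min; have [mx|mx] := leP m (Num.floor x).
  apply/orP; left; rewrite ger0_norm ?lerB// ?ler_int//.
  by rewrite subr_ge0 (le_trans _ le_x)// ler_int.
apply/orP; right; have : t + 1 <= m%:~R.
  by rewrite -[1]/1%:~R -intrD ler_int lezD1.
by rewrite ler_normr => ?; apply/orP; right; lra.
Qed.

(** * Pairing finitely supported functions with arbitrary functions; norm estimates *)

Section Pairing.
Context (R : realType) (n : nat).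
Implicit Types (x y : finSupp R n) (p q : 'rV[R]_n) (V : lmodType R).

Definition supp x : seq 'rV[R]_n := fset_set [set p | x p != 0].

Lemma mem_supp x p : (p \in supp x) = (x p != 0).
Proof. by rewrite in_fset_set ?mem_setE//; exact: finSupp_finite. Qed.

Lemma supp_uniq x : uniq (supp x).
Proof. exact: fset_uniq. Qed.

(** Values in any module let one definition cover both real functionals and the vector sum
    [pairing id x]. *)
Definition pairing V (F : 'rV[R]_n -> V) x : V :=
  \sum_(p \in [set: 'rV[R]_n]) x p *: F p.

Lemma pairing_seq V (F : 'rV[R]_n -> V) x (s : seq 'rV[R]_n) :
  uniq s -> {subset supp x <= s} ->
  pairing F x = \sum_(p <- s) x p *: F p.
Proof.
move=> us xs; rewrite /pairing (fsbigTE [fset p in s]%fset) => [|p].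
  by apply: perm_big; apply: uniq_perm => // p; rewrite inE.
rewrite !inE => ps; have /eqP -> : x p == 0.
  by apply: contraNT ps; rewrite -mem_supp => /xs.
by rewrite scale0r.
Qed.

Lemma pairing_supp V (F : 'rV[R]_n -> V) x :
  pairing F x = \sum_(p <- supp x) x p *: F p.
Proof. by apply: pairing_seq => //; exact: supp_uniq. Qed.

Lemma pairing_is_linear V (F : 'rV[R]_n -> V) : linear (pairing F).
Proof.
move=> k x y; pose s := undup (supp x ++ supp y).
have sx : {subset supp x <= s} by move=> p px; rewrite mem_undup mem_cat px.
have sy : {subset supp y <= s}.
  by move=> p py; rewrite mem_undup mem_cat py orbT.
have sxy : {subset supp (k *: x + y) <= s}.
  move=> p; apply: contraTT => ps.
  rewrite mem_supp negbK [X in X == 0](_ : _ = k * x p + y p)//.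
  have /negPn/eqP-> : ~~ (x p != 0).
    by rewrite -mem_supp; apply: contra ps; exact: sx.
  have /negPn/eqP-> : ~~ (y p != 0).
    by rewrite -mem_supp; apply: contra ps; exact: sy.
  by rewrite mulr0 addr0.
rewrite !(@pairing_seq _ _ _ s) ?undup_uniq// scaler_sumr -big_split/=.
by apply: eq_bigr => p _; rewrite scalerA -scalerDl.
Qed.

HB.instance Definition _ V (F : 'rV[R]_n -> V) :=
  GRing.isLinear.Build R (finSupp R n) V _ (pairing F) (pairing_is_linear F).

Lemma point_fin_supp q : (fun p => (p == q)%:R : R) \in @fin_supp R n.
Proof.
apply/fin_suppP; apply: sub_finite_set (finite_set1 q) => p /=.
by case: (eqVneq p q) => // _; rewrite eqxx.
Qed.

Definition point q : finSupp R n := FinSupp (point_fin_supp q).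

Lemma pointE q p : point q p = (p == q)%:R. Proof. by []. Qed.

Lemma pairing_point V (F : 'rV[R]_n -> V) q : pairing F (point q) = F q.
Proof.
rewrite (@pairing_seq _ _ _ [:: q])// ?big_seq1 ?pointE ?eqxx ?scale1r//.
by move=> p; rewrite mem_supp pointE inE; case: (p == q); rewrite // eqxx.
Qed.

(** Makes evaluation at [q] a linear functional of the same kind as the others. *)
Lemma pairing_eval q x : pairing (fun p => (p == q)%:R : R^o) x = x q.
Proof.
pose s := undup (q :: supp x).
have us : uniq s by exact: undup_uniq.
have sE p : (p \in s) = (p == q) || (p \in supp x) by rewrite mem_undup inE.
rewrite (@pairing_seq _ _ _ s)// => [|p px]; last by rewrite sE px orbT.
rewrite (bigD1_seq q)//= ?sE ?eqxx// big1 ?addr0 => [|p /negbTE->].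
  by rewrite /GRing.scale/= mulr1.
exact: scaler0.
Qed.

Lemma addE x y p : (x + y) p = x p + y p. Proof. by []. Qed.

Lemma scaleE (k : R) x p : (k *: x) p = k * x p. Proof. by []. Qed.

Lemma finSuppP x y : (forall p, x p = y p) -> x = y.
Proof. by move=> xy; apply/val_inj/funext. Qed.

Lemma finSupp_sum x : x = \sum_(p <- supp x) x p *: point p.
Proof.
apply: finSuppP => q; rewrite -!(pairing_eval q) linear_sum/= pairing_supp.
by apply: eq_bigr => p _; rewrite linearZ/= pairing_point.
Qed.

Lemma restr_fin_supp (P : pred 'rV[R]_n) x :
  (fun p => if P p then x p else 0) \in @fin_supp R n.
Proof.
apply/fin_suppP; apply: sub_finite_set (finSupp_finite x) => p /=.
by case: (P p); rewrite // eqxx.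
Qed.

Definition restr P x : finSupp R n := FinSupp (restr_fin_supp P x).

Lemma restrE P x p : restr P x p = if P p then x p else 0. Proof. by []. Qed.

Lemma restrD P x : restr P x + restr (predC P) x = x.
Proof.
apply: finSuppP => p.
rewrite [LHS](_ : _ = restr P x p + restr (predC P) x p)// !restrE /=.
by case: (P p); rewrite /= ?addr0 ?add0r.
Qed.

Lemma pairing_restr V P (F G : 'rV[R]_n -> V) x :
  pairing F (restr P x) + pairing G (restr (predC P) x) =
  pairing (fun p => if P p then F p else G p) x.
Proof.
have sub Q : {subset supp (restr Q x) <= supp x}.
  by move=> p; rewrite !mem_supp restrE; case: (Q p); rewrite // eqxx.
rewrite !(@pairing_seq _ _ _ (supp x)) ?supp_uniq// -big_split/=.
apply: eq_bigr => p _.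
by case: (P p); rewrite /= scale0r ?addr0 ?add0r.
Qed.

Lemma nonneg_restr P x : nonneg R n x -> nonneg R n (restr P x).
Proof. by move=> x0 p; rewrite restrE; case: (P p). Qed.

Lemma nonneg0 : nonneg R n 0.
Proof. by move=> p; apply: lexx. Qed.

Lemma nonnegD x y : nonneg R n x -> nonneg R n y -> nonneg R n (x + y).
Proof. by move=> x0 y0 p; rewrite addE addr_ge0. Qed.

Lemma nonnegZ (k : R) x : 0 <= k -> nonneg R n x -> nonneg R n (k *: x).
Proof. by move=> k0 x0 p; rewrite scaleE mulr_ge0. Qed.

Lemma nonneg_point q : nonneg R n (point q).
Proof. by move=> p; rewrite pointE ler0n. Qed.

Lemma nonneg_sum (I : Type) (s : seq I) (l : I -> R) (f : I -> finSupp R n) :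
  (forall i, 0 <= l i) -> (forall i, nonneg R n (f i)) ->
  nonneg R n (\sum_(i <- s) l i *: f i).
Proof.
move=> l0 f0; apply: (big_ind (nonneg R n)) => [|x y|i _].
- exact: nonneg0.
- exact: nonnegD.
- exact: nonnegZ.
Qed.

Lemma pairing_ge0 (F : 'rV[R]_n -> R^o) x : nonneg R n x ->
  (forall p, p \in supp x -> 0 <= F p) -> 0 <= pairing F x.
Proof.
by move=> x0 F0; rewrite pairing_supp big_seq sumr_ge0// => p /F0 ?; exact: mulr_ge0.
Qed.

(** The sum norm suits decompositions along the coordinate axes, whose total mass it measures
    exactly. *)
Definition l1 p : R := \sum_i `|p 0 i|.

Lemma l1_ge0 p : 0 <= l1 p. Proof. exact: sumr_ge0. Qed.

Lemma ler_coord_l1 p i : `|p 0 i| <= l1 p.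
Proof. by rewrite /l1 (bigD1 i)//= lerDl sumr_ge0. Qed.

Lemma ler_coord_enorm p i : `|p 0 i| <= enorm p.
Proof.
rewrite -sqrtr_sqr ler_sqrt ?sumr_ge0// => [|j _]; last exact: sqr_ge0.
by rewrite (bigD1 i)//= lerDl sumr_ge0// => j _; exact: sqr_ge0.
Qed.

Lemma l1_le_enorm p : l1 p <= n%:R * enorm p.
Proof.
rewrite (@le_trans _ _ (\sum_(i < n) enorm p))//.
  by apply: ler_sum => i _; exact: ler_coord_enorm.
by rewrite sumr_const card_ord mulr_natl.
Qed.

Lemma enorm_le_l1 p : enorm p <= l1 p.
Proof.
rewrite -[leRHS]ger0_norm ?l1_ge0// -sqrtr_sqr ler_sqrt ?sqr_ge0// /l1.
(* Keeping [0 <= b] in the invariant makes the cross term of the squared sum nonnegative. *)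
pose K (a b : R) := 0 <= b /\ a <= b ^+ 2.
suff [] : K (\sum_i p 0 i ^+ 2) (\sum_i `|p 0 i|) by [].
apply: (big_ind2 K) => [|a b c d [b0 ab] [d0 cd]|i _]; rewrite /K.
- by rewrite expr0n.
- by split; [exact: addr_ge0|nra].
- by rewrite normr_ge0 real_normK ?num_real.
Qed.

Lemma l1_pairing x : nonneg R n x ->
  l1 (pairing id x) <= pairing (l1 : _ -> R^o) x.
Proof.
move=> x0; rewrite !pairing_supp.
under [leRHS]eq_bigr do rewrite /GRing.scale/= /l1 mulr_sumr.
rewrite exchange_big/=; apply: ler_sum => i _; rewrite summxE.
apply: le_trans (ler_norm_sum _ _ _) _; apply: ler_sum => p _.
by rewrite mxE normrM ger0_norm.
Qed.

(** However wild [psi] is, a representation by signed unit vectors involves only finitely many of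
    its values, so its cost grows at most linearly in [r]. *)
Lemma axis_rep (psi : 'rV[R]_n -> R^o) : exists2 K : R, 0 <= K &
  forall r, exists s, [/\ nonneg R n s, pairing id s = r &
    pairing psi s <= K * l1 r].
Proof.
pose e i : 'rV[R]_n := delta_mx 0 i.
pose k i := `|psi (e i)| + `|psi (- e i)|.
have k0 i : 0 <= k i by exact: addr_ge0.
exists (\sum_i k i) => [|r]; first exact: sumr_ge0.
exists (\sum_i `|r 0 i| *: point (Num.sg (r 0 i) *: e i)); split.
- by apply: nonneg_sum => // i; exact: nonneg_point.
- rewrite linear_sum/= [RHS]row_sum_delta; apply: eq_bigr => i _.
  by rewrite linearZ/= pairing_point scalerA mulrC -numEsg.
rewrite linear_sum/= mulr_sumr; apply: ler_sum => i _.
rewrite linearZ/= pairing_point.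
rewrite [leLHS](_ : _ = `|r 0 i| * psi (Num.sg (r 0 i) *: e i))//.
have [->|ri] := eqVneq (r 0 i) 0; first by rewrite normr0 mul0r mulr0.
rewrite mulrC ler_wpM2r//; apply: le_trans (ler_norm _) _.
apply: (@le_trans _ _ (k i)); last by rewrite (bigD1 i)//= lerDl sumr_ge0.
case: (ltgtP (r 0 i) 0) ri => [r0|r0|-> /eqP//] _.
  by rewrite ltr0_sg// scaleN1r lerDr.
by rewrite gtr0_sg// scale1r lerDl.
Qed.

(** Exhibits the norm as a weighted sum norm, with weight 1 at the origin and the length of [p]
    elsewhere. *)
Lemma star_normE x : star_norm x =
  \sum_(p <- supp x) ((p == 0)%:R + enorm p) * `|x p|.
Proof.
rewrite /star_norm (@fsumT_seq _ _ _ [set p | x p != 0]); last 2 first.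
- exact: finSupp_finite.
- by move=> p /=; apply: contra_neq => ->; rewrite normr0 mulr0.
under [RHS]eq_bigr do rewrite mulrDl.
rewrite big_split/=; congr (_ + _).
have [x0|x0] := eqVneq (x 0) 0.
  rewrite x0 normr0 big1// => p _; case: eqP => [->|]; last by rewrite mul0r.
  by rewrite x0 normr0 mulr0.
rewrite (bigD1_seq 0) ?supp_uniq ?mem_supp//= eqxx mul1r big1 ?addr0//.
by move=> p /negbTE->; rewrite mul0r.
Qed.

Lemma norm_pairing_le (K : R) (F : 'rV[R]_n -> R^o) x :
  (forall p, `|F p| <= K * ((p == 0)%:R + enorm p)) ->
  `|pairing F x| <= K * `|x|.
Proof.
move=> FK; rewrite finSupp_normE star_normE mulr_sumr pairing_supp.
apply: le_trans (ler_norm_sum _ _ _) _; apply: ler_sum => p _.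
by rewrite normrM mulrC mulrA ler_wpM2r.
Qed.

Lemma norm_point p : `|point p| = (p == 0)%:R + enorm p.
Proof.
rewrite finSupp_normE star_normE (perm_big [:: p]) ?big_seq1 ?pointE ?eqxx/=.
  by rewrite normr1 mulr1.
apply: uniq_perm; rewrite ?supp_uniq// => q; rewrite mem_supp pointE inE.
by case: (q == p); rewrite ?oner_eq0 ?eqxx.
Qed.

End Pairing.

(** * Closures and convex hulls *)

Lemma closure_normP (R : realType) (V : normedModType R) (C : set V) y :
  closure C y <-> forall e : R, 0 < e -> exists2 x, C x & `|x - y| < e.
Proof.
split=> [yC e e0|yC B /nbhs_ballP[e /= e0 eB]].
  have [x [Cx xy]] := yC _ (nbhsx_ballx y e e0).
  by exists x => //; rewrite distrC; move: xy; rewrite -ball_normE.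
have [x Cx xy] := yC e e0; exists x; split=> //; apply: eB.
by rewrite -ball_normE /= distrC.
Qed.

Section Hull.
Context (R : realType) (E : lmodType R).
Implicit Types (A B : set E).

Lemma sub_convex_hull A : A `<=` convex_hull A.
Proof. exact: sub_smallest. Qed.

Lemma convex_hull_min A B : convex_set B -> A `<=` B -> convex_hull A `<=` B.
Proof. exact: smallest_sub. Qed.

Lemma convex_hull_convex A : convex_set (convex_hull A).
Proof.
apply/convex_setP => x y t t01 Ax Ay B [convB AB].
by apply: ((convex_setP B).1 convB) => //; [exact: Ax|exact: Ay].
Qed.

Lemma convex_halfspace (f : {scalar E}) (a : R) : convex_set [set x | a <= f x].
Proof.
apply/convex_setP => x y t /andP[t0 t1] /= ax ay.
by rewrite linearD !linearZ/=; nra.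
Qed.

End Hull.

(** * Integrality, and membership expressed through [pairing] *)

Section Lattice.
Context (R : realType) (n : nat).
Implicit Types (x y : finSupp R n) (p q b : 'rV[R]_n).

Definition nat_valued : set (finSupp R n) := [set x | forall p, x p \is a Num.nat].

Lemma int_latticeD p q : int_lattice R n p -> int_lattice R n q ->
  int_lattice R n (p + q).
Proof. by move=> p0 q0 i; rewrite mxE rpredD. Qed.

Lemma nat_valued_nonneg x : nat_valued x -> nonneg R n x.
Proof. by move=> xnat p; exact: natr_ge0. Qed.

Lemma nat_valued_restr (P : pred 'rV[R]_n) x :
  nat_valued x -> nat_valued (restr P x).
Proof. by move=> xnat p; rewrite restrE; case: (P p); rewrite ?rpred0. Qed.

Lemma nat_valuedD x y : nat_valued x -> nat_valued y -> nat_valued (x + y).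
Proof. by move=> xnat ynat p; rewrite addE rpredD. Qed.

Lemma nat_valued_point (k : nat) q : nat_valued (k%:R *: point q).
Proof. by move=> p; rewrite scaleE pointE rpredM ?natr_nat. Qed.

Lemma M_P b x y : M_ b (x, y) <-> [/\ nonneg R n x, nat_valued y &
  exists2 z, int_lattice R n z & pairing id x + pairing id y = b + z].
Proof. by []. Qed.

Lemma I_P b x : I_ b x <-> nat_valued x /\
  exists2 z, int_lattice R n z & pairing id x = b + z.
Proof.
have sumE : pairing id (0 : finSupp R n) + pairing id x = pairing id x.
  by rewrite linear0 add0r.
split=> [/M_P[_ xnat]|[xnat xz]]; first by rewrite sumE.
by apply/M_P; rewrite sumE; split; first exact: nonneg0.
Qed.

Lemma H_P (psi pi : 'rV[R]_n -> R) a x y :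
  H_ psi pi a (x, y) <->
  a <= pairing (psi : _ -> R^o) x + pairing (pi : _ -> R^o) y.
Proof.
have sumE (F : 'rV[R]_n -> R) (w : finSupp R n) :
    \sum_(r \in [set: 'rV[R]_n]) F r * w r = pairing (F : _ -> R^o) w.
  by apply: eq_fsbigr => r _; rewrite mulrC.
by rewrite /H_ /= !sumE.
Qed.

(** * Closed half-spaces, and the closed hull inside [G_ b] *)

Lemma weight_gt0 p : 0 < (p == 0)%:R + enorm p.
Proof.
have [->|p0] := eqVneq p 0; first by rewrite ltr_pwDl ?enorm_ge0 ?ltr01.
rewrite add0r lt_neqAle enorm_ge0 andbT eq_sym.
by apply: contra_neq p0; exact: enorm_eq0.
Qed.

(** The bound on [F] by the weights of the norm makes [pairing F] Lipschitz, so the half-space is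
    closed. *)
Lemma closure_halfspace (A : set (finSupp R n)) (F : 'rV[R]_n -> R^o) (K a : R) :
  (forall p, `|F p| <= K * ((p == 0)%:R + enorm p)) ->
  A `<=` [set x | a <= pairing F x] -> closure A `<=` [set x | a <= pairing F x].
Proof.
move=> FK AF y /closure_normP yA; rewrite /= leNgt; apply/negP => ya.
have K0 : 0 <= K.
  by have := le_trans (normr_ge0 _) (FK 0); rewrite pmulr_lge0 ?weight_gt0.
have K1 : 0 < K + 1 by rewrite ltr_wpDl.
have [|x /AF/= ax xy] := yA ((a - pairing F y) / (K + 1)).
  by rewrite divr_gt0 ?subr_gt0.
have := norm_pairing_le (x - y) FK; rewrite linearB/= => /(le_trans (ler_norm _)).
rewrite ltr_pdivlMr// in xy; have := normr_ge0 (x - y); nra.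
Qed.

Lemma convex_nonneg : convex_set (nonneg R n).
Proof.
apply/convex_setP => x y t /andP[t0 t1] x0 y0.
by apply: nonnegD; apply: nonnegZ => //; rewrite subr_ge0.
Qed.

Lemma hull_nonneg b : convex_hull (I_ b) `<=` nonneg R n.
Proof.
apply: convex_hull_min; first exact: convex_nonneg.
by move=> x /I_P[xnat _]; exact: nat_valued_nonneg.
Qed.

Lemma closure_hull_sub_G b : closure (convex_hull (I_ b)) `<=` G_ b.
Proof.
move=> y ycl; split.
- exact: nonneg0.
- move=> q; rewrite /= -(pairing_eval q y).
  apply: (closure_halfspace (K := ((q == 0)%:R + enorm q)^-1)) ycl => [p|x xI /=].
    case: (eqVneq p q) => [->|_]; first by rewrite normr1 mulVf ?gt_eqF ?weight_gt0.
    by rewrite normr0 mulr_ge0 ?invr_ge0 ?ltW ?weight_gt0.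
  by rewrite pairing_eval; exact: hull_nonneg xI q.
move=> psi pi a valid; apply/H_P; rewrite linear0 add0r /=.
have [K K0 KP] := axis_rep psi.
pose P : pred 'rV[R]_n := mem (supp y).
(* [pi] may grow arbitrarily fast, so its pairing need not be continuous; that of [F] is, and it has
   the same value at [y]. *)
pose F : 'rV[R]_n -> R^o := fun p => if P p then pi p else K * l1 p.
have -> : pairing (pi : _ -> R^o) y = pairing F y.
  rewrite !pairing_supp big_seq [RHS]big_seq.
  by apply: eq_bigr => p yp; rewrite /F /P /= yp.
(* Ratio of [pi] to the weight; the sum over the finite support of [y] bounds every ratio there. *)
pose k p := `|pi p| / ((p == 0)%:R + enorm p).
have k0 p : 0 <= k p by rewrite divr_ge0// ltW ?weight_gt0.
apply: (closure_halfspace (K := K * n%:R + \sum_(p <- supp y) k p)) ycl => [p|].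
  rewrite /F /P /=; case: ifP => [yp|_].
    have -> : `|pi p| = k p * ((p == 0)%:R + enorm p).
      by rewrite mulfVK ?gt_eqF ?weight_gt0.
    rewrite ler_wpM2r ?(ltW (weight_gt0 _))// (bigD1_seq p) ?supp_uniq//=.
    by rewrite addrCA lerDl addr_ge0 ?mulr_ge0 ?sumr_ge0.
  rewrite ger0_norm ?mulr_ge0 ?l1_ge0// (@le_trans _ _ (K * n%:R * enorm p))//.
    by rewrite -mulrA ler_wpM2l ?l1_le_enorm.
  apply: ler_pM; rewrite ?mulr_ge0 ?enorm_ge0//.
    by rewrite lerDl sumr_ge0.
  by rewrite lerDr.
apply: convex_hull_min; first exact: convex_halfspace.
move=> x /I_P[xnat [z zint xz]] /=.
(* Trading the part [v] off the support for an [s] with the same vector sum gives an element of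
   [M_ b], to which the original valid tuple applies. *)
pose v := restr (predC P) x.
have v0 : nonneg R n v by exact/nonneg_restr/nat_valued_nonneg.
have [s [s0 sE sK]] := KP (pairing id v).
have /valid.2/H_P : M_ b (s, restr P x).
  apply/M_P; split=> //; first exact: nat_valued_restr.
  exists z => //; rewrite sE -xz.
  by rewrite -linearD/= addrC restrD.
move=> /le_trans; apply; rewrite -pairing_restr addrC lerD2l (le_trans sK)//.
rewrite [leRHS](_ : _ = K * pairing (l1 (n:=n) : _ -> R^o) v).
  by rewrite ler_wpM2l// l1_pairing.
by rewrite !pairing_supp mulr_sumr; apply: eq_bigr => p _; exact: mulrCA.
Qed.

(** * Translating the hull and its closure by nonnegative functions *)

Lemma hull_shift_nat b z x : nat_valued z -> int_lattice R n (pairing id z) ->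
  convex_hull (I_ b) x -> convex_hull (I_ b) (x + z).
Proof.
move=> znat zint; move: x.
apply: (@convex_hull_min _ _ _ [set x | convex_hull (I_ b) (x + z)]).
  apply/convex_setP => x y t t01 /= xz yz.
  have := (convex_setP _).1 (@convex_hull_convex _ _ (I_ b)) _ _ _ t01 xz yz.
  by rewrite !scalerDr addrACA -[X in _ + X]scalerDl [t + _]addrC subrK scale1r.
move=> x /I_P[xnat [w wint xw]]; apply: sub_convex_hull; apply/I_P.
split; first exact: nat_valuedD.
exists (w + pairing id z); first exact: int_latticeD.
by rewrite linearD/= xw addrA.
Qed.

(** For an integer [N >= t], the translate lies on the segment from [x] to [x + N%:R *: z], both in
    the hull. *)
Lemma hull_shift b z x (t : R) : 0 <= t -> nat_valued z ->
  int_lattice R n (pairing id z) ->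
  convex_hull (I_ b) x -> convex_hull (I_ b) (x + t *: z).
Proof.
move=> t0 znat zint xI; pose N := (Num.truncn t).+1.
have N0 : 0 < N%:R :> R by rewrite ltr0n.
have tN : t <= N%:R by exact/ltW/truncnS_gt.
have NI (k : nat) : convex_hull (I_ b) (x + k%:R *: z).
  elim: k => [|k IHk]; first by rewrite scale0r addr0.
  by rewrite -natr1 scalerDl scale1r addrA; exact: hull_shift_nat.
have -> : x + t *: z = (t / N%:R) *: (x + N%:R *: z) + (1 - t / N%:R) *: x.
  rewrite scalerDr scalerA mulfVK ?gt_eqF// addrAC -scalerDl.
  by rewrite [_ + (1 - _)]addrC subrK scale1r.
apply: ((convex_setP _).1 (@convex_hull_convex _ _ (I_ b))) => //.
by rewrite divr_ge0 ?(ltW N0)//= ler_pdivrMr// mul1r.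
Qed.

(* Approximate [point p] by [N^-1 *: z], z the sum of N copies of p and one of
   [d := - N *: p] modulo the lattice, with d small: the norm charges [enorm d]
   for the latter, except at d = 0, where it is simply omitted. *)
Lemma closure_shift_point b p x (t : R) : 0 <= t -> convex_hull (I_ b) x ->
  closure (convex_hull (I_ b)) (x + t *: point p).
Proof.
move=> t0 xI; apply/closure_normP => e e0.
have t1 : 0 < t + 1 by rewrite ltr_wpDl.
have n1 : 0 < n%:R + 1 :> R by rewrite ltr_wpDl.
(* The final error is at most [t * n%:R] times this tolerance; adding 1 to both factors keeps the
   denominator positive and the estimate strict. *)
have [|N [N0 [z zint zN]]] := @dirichlet R n p (e / ((t + 1) * (n%:R + 1))).
  by rewrite divr_gt0 ?mulr_gt0.
set d := z - N%:R *: p in zN.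
have NR : 1 <= N%:R :> R by rewrite ler1n.
pose w := N%:R *: point p + (d != 0)%:R *: point d.
exists (x + (t / N%:R) *: w).
  apply: hull_shift => //; first by rewrite divr_ge0.
    by apply: nat_valuedD; exact: nat_valued_point.
  rewrite linearD !linearZ/= !pairing_point.
  have -> : (d != 0)%:R *: d = d.
    by case: eqP => [->|]; rewrite ?scaler0 ?scale1r.
  by rewrite addrC subrK.
have -> : x + (t / N%:R) *: w - (x + t *: point p) =
    (t / N%:R) *: ((d != 0)%:R *: point d).
  rewrite opprD addrACA subrr add0r scalerDr scalerA mulfVK; last first.
    by rewrite gt_eqF ?(lt_le_trans _ NR).
  by rewrite addrAC subrr add0r.
rewrite normrZ ger0_norm ?divr_ge0// normrZ norm_point normr_nat.
have -> : (d != 0)%:R * ((d == 0)%:R + enorm d) = (d != 0)%:R * enorm d.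
  by case: (d == 0); rewrite ?mul0r ?add0r.
have dn : enorm d <= n%:R * (e / ((t + 1) * (n%:R + 1))).
  rewrite (le_trans (enorm_le_l1 _))//.
  set c := e / _ in zN *; apply: (@le_trans _ _ (\sum_(i < n) c)); last first.
    by rewrite sumr_const card_ord mulr_natl.
  by apply: ler_sum => i _; exact/ltW.
have : t / N%:R * ((d != 0)%:R * enorm d) <= t * enorm d.
  apply: ler_pM; rewrite ?divr_ge0 ?mulr_ge0 ?enorm_ge0//.
    by rewrite ler_pdivrMr ?(lt_le_trans _ NR)// ler_peMr.
  by case: (d == 0); rewrite ?mul0r ?mul1r ?enorm_ge0.
move=> /le_lt_trans; apply; apply: le_lt_trans (ler_wpM2l t0 dn) _.
have -> : t * (n%:R * (e / ((t + 1) * (n%:R + 1)))) =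
    e * (t * n%:R) / ((t + 1) * (n%:R + 1)).
  by field; rewrite !gt_eqF.
rewrite ltr_pdivrMr ?mulr_gt0// ltr_pM2l//.
have := ler0n R n; nra.
Qed.

(** The weighted points of [u] are added one at a time. Since [closure_shift_point] starts from the
    hull itself, a closure point is first approximated within [e / 2]. *)
Lemma closure_shift b (u x : finSupp R n) : nonneg R n u ->
  closure (convex_hull (I_ b)) x -> closure (convex_hull (I_ b)) (x + u).
Proof.
move=> u0; rewrite (finSupp_sum u).
elim: (supp u) x => [|p s IHs] x xcl; first by rewrite big_nil addr0.
rewrite big_cons addrA; apply: IHs; apply/closure_normP => e e0.
have e2 : 0 < e / 2 by rewrite divr_gt0.
have /closure_normP/(_ _ e2)[x1 x1I x1x] := xcl.
have /closure_normP/(_ _ e2)[x2 x2I x2x] := @closure_shift_point b p _ _ (u0 p) x1I.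
exists x2 => //; rewrite (splitr e) -(subrKA (x1 + u p *: point p)).
apply: le_lt_trans (ler_normD _ _) _; apply: ltrD => //.
by rewrite [in X in _ - X]addrC [x1 + _]addrC opprD addrACA subrr add0r.
Qed.

Lemma hull_add_sub_closure b :
  [set x + y | x in convex_hull (I_ b) & y in nonneg R n] `<=`
  closure (convex_hull (I_ b)).
Proof.
by move=> _ [x xI [u u0 <-]]; apply: closure_shift => //; exact: subset_closure.
Qed.

(** * From [G_ b] to the hull plus the nonnegative cone *)

Lemma finite_nat_box (s : seq 'rV[R]_n) (N : nat) : finite_set
  [set x | [/\ nat_valued x, {subset supp x <= s} & forall p, x p <= N%:R]].
Proof.
elim: s => [|q s IHs].
  apply: sub_finite_set (finite_set1 0) => x [_ xs _] /=.
  rewrite (finSupp_sum x); case: (supp x) xs => [|p l /(_ p)].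
    by rewrite big_nil.
  by rewrite mem_head => /(_ isT).
apply: sub_finite_set (finite_image2 (fun c x => c%:R *: point q + x)
  (finite_II N.+1) IHs) => x [xnat xs xN].
exists (Num.truncn (x q)).
  by rewrite /= ltnS -(ler_nat R) truncnK//; exact: xnat.
exists (restr (predC1 q) x).
  split=> [|p|p]; first exact: nat_valued_restr.
    rewrite mem_supp restrE /=; have [//|pq] := eqVneq p q; first by rewrite eqxx.
    by rewrite -mem_supp => /xs; rewrite inE (negbTE pq).
  by rewrite restrE; case: ifP => // _; rewrite ler0n.
apply: finSuppP => p; rewrite addE scaleE pointE restrE /= truncnK; last exact: xnat.
by have [->|pq] := eqVneq p q; rewrite ?mulr1 ?addr0// mulr0 add0r.
Qed.

(* Positivity of pi leaves finitely many x with [pairing pi x < 1]; each of them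
   outside I_b has a positive distance to the lattice b + Z^n. *)
Lemma lattice_gap b (s : seq 'rV[R]_n) (pi : 'rV[R]_n -> R^o) :
  (forall p, p \in s -> 0 < pi p) ->
  exists2 C : R, 0 <= C & forall x r z,
    nat_valued x -> {subset supp x <= s} -> pairing pi x < 1 -> ~ I_ b x ->
    int_lattice R n z -> pairing id x + r = b + z -> 1 <= C * l1 r.
Proof.
move=> pi0.
(* [c x] is the inverse distance to the integers of a nonintegral coordinate of [pairing id x - b].
   If all coordinates are integers, [x] lies in [I_ b] and the claim is vacuous. *)
have /choice[c cP] : forall x, exists c : R, 0 <= c /\
    (nat_valued x -> ~ I_ b x -> forall r z, int_lattice R n z ->
      pairing id x + r = b + z -> 1 <= c * l1 r).
  move=> x.
  have [xint|] := pselect (int_lattice R n (pairing id x - b)).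
    exists 0; split=> // xnat []; apply/I_P; split=> //.
    by exists (pairing id x - b) => //; rewrite addrC subrK.
  move=> /existsNP[i /negP/nonint_dist[d d0 dP]].
  exists d^-1; split=> [|_ _ r z zint xr]; first by rewrite invr_ge0 ltW.
  rewrite mulrC ler_pdivlMr// mul1r (le_trans (dP _ (zint i)))//.
  apply: le_trans (ler_coord_l1 r i); rewrite -normrN.
  suff -> : r 0 i = - ((pairing id x - b) 0 i - z 0 i) by [].
  have -> : r = b + z - pairing id x by rewrite -xr addrC addKr.
  by rewrite !mxE; ring.
(* Each value satisfies [x p * pi p < 1], hence is below [(pi p)^-1]; this [N] bounds all of them at
   once. *)
pose N := (\sum_(p <- undup s) (Num.truncn (pi p)^-1).+1)%N.
pose U : set (finSupp R n) :=
  [set x | [/\ nat_valued x, {subset supp x <= s} & forall p, x p <= N%:R]].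
have Ufin : finite_set U by exact: finite_nat_box.
exists (\sum_(x <- fset_set U) c x).
  by apply: sumr_ge0 => x _; have [] := cP x.
move=> x r z xnat xs pix xI zint xr.
apply: le_trans ((cP x).2 xnat xI r z zint xr) _.
apply: ler_wpM2r; first exact: l1_ge0.
have xU : x \in fset_set U.
  rewrite in_fset_set//; apply/mem_set; split=> // p.
  have [ps|ps] := boolP (p \in supp x); last first.
    by move: ps; rewrite mem_supp negbK => /eqP->; rewrite ler0n.
  have := xs p ps => sp.
  have : x p * pi p < 1.
    apply: le_lt_trans pix; rewrite pairing_supp (bigD1_seq p) ?supp_uniq//=.
    rewrite lerDl big_seq_cond sumr_ge0// => q /andP[/xs/pi0/ltW q0 _].
    by apply: mulr_ge0 => //; exact: natr_ge0.
  rewrite -ltr_pdivlMr ?pi0// mul1r => /ltW/le_trans; apply.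
  apply: le_trans (ltW (truncnS_gt _)) _; rewrite ler_nat /N.
  by rewrite (bigD1_seq p) ?undup_uniq ?mem_undup//= leq_addr.
rewrite (bigD1_seq x) ?fset_uniq//= lerDl.
by apply: sumr_ge0 => y _; have [] := cP y.
Qed.

(** Extending [pi] by [C * l1] gives a valid tuple: if the part of an element of [M_ b] on the
    support of [y] has value below 1, it is not in [I_ b], so the remaining mass has to bridge the
    lattice gap and contributes at least 1. *)
Lemma G_ge1 b (y : finSupp R n) (pi : 'rV[R]_n -> R^o) :
  G_ b y -> (forall p, p \in supp y -> 0 < pi p) ->
  (forall x, I_ b x -> {subset supp x <= supp y} -> 1 <= pairing pi x) ->
  1 <= pairing pi y.
Proof.
move=> [_ y0 yG] pi0 piI.
have [C C0 CP] := lattice_gap b pi0.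
pose P : pred 'rV[R]_n := mem (supp y).
pose psi (p : 'rV[R]_n) : R^o := C * l1 p.
pose F p : R^o := if P p then pi p else psi p.
have -> : pairing pi y = pairing F y.
  rewrite !pairing_supp big_seq [RHS]big_seq.
  by apply: eq_bigr => p yp; rewrite /F /P /= yp.
suff /yG/H_P : valid_tuple b psi F 1 by rewrite linear0 add0r.
split; first by rewrite !inE eqxx !orbT.
move=> [s x] /M_P[s0 xnat [z zint sx]]; apply/H_P.
have psiE w : pairing psi w = C * pairing (l1 (n:=n) : _ -> R^o) w.
  by rewrite !pairing_supp mulr_sumr; apply: eq_bigr => p _; exact: mulrCA.
rewrite -(pairing_restr P) addrCA -linearD/=.
set u := restr P x; set v := s + _.
have v0 : nonneg R n v.
  by apply: nonnegD => //; exact/nonneg_restr/nat_valued_nonneg.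
have unat : nat_valued u by exact: nat_valued_restr.
have uy : {subset supp u <= supp y}.
  by move=> p; rewrite mem_supp /u restrE /P /=; case: ifP => // _; rewrite eqxx.
have psi_ge0 : 0 <= pairing psi v.
  by apply: pairing_ge0 => // p _; rewrite mulr_ge0 ?l1_ge0.
have [le1|lt1] := lerP 1 (pairing pi u); first by rewrite ler_wpDr.
have piu_ge0 : 0 <= pairing pi u.
  by apply: pairing_ge0 => [|p /uy/pi0/ltW//]; exact: nat_valued_nonneg.
rewrite ler_wpDl// psiE.
apply: (@le_trans _ _ (C * l1 (pairing id v))); last first.
  by rewrite ler_wpM2l ?l1_pairing.
apply: (CP u _ z) => //; first by move=> /piI/(_ uy); rewrite leNgt lt1.
by rewrite /v linearD/= addrCA -linearD/= restrD.
Qed.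

Lemma G_sub_hull_add b :
  G_ b `<=` [set x + y | x in convex_hull (I_ b) & y in nonneg R n].
Proof.
move=> y yG; have [_ y0 _] := yG.
pose v (x : finSupp R n) p := Num.truncn (x p).
have [D [Dfin DI DP]] := dickson v (supp y)
  [set x | I_ b x /\ {subset supp x <= supp y}].
pose I := (finSupp R n + 'rV[R]_n)%type.
pose s : seq I := map inl (fset_set D) ++ map inr (supp y).
have us : uniq s.
  rewrite cat_uniq !map_inj_uniq ?fset_uniq ?supp_uniq//=; last 2 first.
  - by move=> ? ? [].
  - by move=> ? ? [].
  by rewrite andbT; apply/hasPn => _ /mapP[p _ ->]; apply/mapP => -[].
(* Functionals on W = {(pi, t)}: (x, 1) for x in D, (e_p, 0) for p in the
   support, to be compared with (y, 1). *)
pose W : lmodType R := (finSupp R n * R^o)%type.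
have lin (x : finSupp R n) (k : R) :
    scalar (fun w : W => pairing (x : _ -> R^o) w.1 + k * w.2).
  by move=> a u w /=; rewrite linearP/= /GRing.scale/=; ring.
pose fn x k : {scalar W} := HB.pack
  (fun w : W => pairing (x : _ -> R^o) w.1 + k * w.2)
  (GRing.isLinear.Build _ _ _ _ _ (lin x k)).
pose a (i : I) := match i with inl x => fn x 1 | inr p => fn (point p) 0 end.
have [[l l0 lE]|[[pi t] api]] := farkas a (fn y 1) us.
  have sE w : fn y 1 w = \sum_(x <- fset_set D) l (inl x) * fn x 1 w +
      \sum_(p <- supp y) l (inr p) * fn (point p) 0 w.
    by rewrite lE big_cat !big_map.
  (* Testing at [(0, 1)] shows that the weights on [D] sum to 1; testing at [(point q, 0)] further
     on recovers the coordinates of [y]. *)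
  have l1E : \sum_(x <- fset_set D) l (inl x) = 1.
    have := sE (0, 1); rewrite /= linear0 !add0r mul1r => ->.
    rewrite [X in _ + X]big1 => [|p _]; last by rewrite linear0; ring.
    by rewrite addr0; apply: eq_bigr => x _; rewrite linear0; ring.
  exists (\sum_(x <- fset_set D) l (inl x) *: x).
    apply: sum_convex => // [|x]; first exact: convex_hull_convex.
    rewrite in_fset_set// => /set_mem/DI[xI _].
    exact: sub_convex_hull.
  exists (\sum_(p <- supp y) l (inr p) *: point p).
    by apply: nonneg_sum => // p; exact: nonneg_point.
  apply: finSuppP => q; rewrite -!(pairing_eval q) linearD !linear_sum/=.
  have := sE (point q, 0); rewrite /= pairing_point mulr0 addr0 pairing_eval => ->.
  congr (_ + _); apply: eq_bigr => x _; rewrite linearZ/= pairing_eval pairing_point.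
    by rewrite addr0.
  by rewrite mul0r addr0 pointE eq_sym.
rewrite /= mul1r => yt; exfalso.
(* The sign change turns the separating vector into a functional with lower bound [t] on [D], which
   [y] violates. *)
pose f p : R^o := - pi p.
have fE x : pairing f x = - pairing (x : _ -> R^o) pi.
  pose r := undup (supp x ++ supp pi).
  rewrite !(@pairing_seq _ _ _ _ _ r) ?undup_uniq//; last 2 first.
  - by move=> p; rewrite mem_undup mem_cat => ->; rewrite orbT.
  - by move=> p; rewrite mem_undup mem_cat => ->.
  by rewrite -sumrN; apply: eq_bigr => p _; rewrite /GRing.scale/= mulrN mulrC.
have f0 p : p \in supp y -> 0 <= f p.
  move=> yp; rewrite oppr_ge0 -pairing_eval.
  have := api (inr p); rewrite /= mul0r addr0; apply.
  by rewrite mem_cat (map_f inr yp) orbT.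
have fD x : D x -> t <= pairing f x.
  move=> Dx; have := api (inl x); rewrite fE /= mul1r -lerBrDr sub0r lerNr; apply.
  by rewrite mem_cat map_f// in_fset_set//; apply/mem_set.
(* Being nonnegative on the support of [y], [f] gives a monotone pairing there, so the bound passes
   from the Dickson elements to all others. *)
have fI x : I_ b x -> {subset supp x <= supp y} -> t <= pairing f x.
  move=> xI xy; have [d Dd dx] := DP x (conj xI xy).
  have [[_ dnat _] dy] := DI _ Dd; have [_ xnat _] := xI.
  apply: le_trans (fD d Dd) _.
  rewrite !(@pairing_seq _ _ _ _ _ (supp y)) ?supp_uniq// big_seq [leRHS]big_seq.
  apply: ler_sum => p yp; rewrite ler_wpM2r ?f0//.
  by rewrite -[leLHS]truncnK ?dnat// -[leRHS]truncnK ?xnat// ler_nat dx.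
have fy : pairing f y < t by rewrite fE; move: yt; lra.
have fy0 : 0 <= pairing f y by exact: pairing_ge0.
(* Positivity of [t] allows rescaling the threshold to the 1 required by [G_ge1]. *)
have t0 : 0 < t by exact: le_lt_trans fy0 fy.
pose one (_ : 'rV[R]_n) : R^o := 1.
have mu0 x : nonneg R n x -> 0 <= pairing one x.
  by move=> x0; apply: pairing_ge0 => // p _; exact: ler01.
(* f is only nonnegative: perturb it to a positive g. *)
pose e := (t - pairing f y) / (pairing one y + 1).
have mu1 : 0 < pairing one y + 1 by rewrite ltr_wpDl ?mu0.
have e0 : 0 < e by rewrite divr_gt0// subr_gt0.
pose g p : R^o := (f p + e) / t.
have gE x : pairing g x = (pairing f x + e * pairing one x) / t.
  rewrite !pairing_supp mulr_sumr -big_split/= mulr_suml.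
  by apply: eq_bigr => p _; rewrite /GRing.scale/= /g /one; ring.
have : 1 <= pairing g y.
  apply: (G_ge1 yG) => [p /f0 fp0|x xI xy].
    by rewrite divr_gt0// ltr_wpDl.
  rewrite gE ler_pdivlMr// mul1r ler_wpDr ?fI// mulr_ge0 ?(ltW e0)// mu0//.
  by case: xI => _ xnat _; exact: nat_valued_nonneg.
apply/negP; rewrite -ltNge gE ltr_pdivrMr// mul1r -ltrBrDl.
rewrite /e mulrAC ltr_pdivrMr// ltr_pM2l ?subr_gt0//.
by rewrite ltrDl.
Qed.

End Lattice.

Theorem theorem2p15 (R : realType) (n : nat) (b : 'rV[R]_n)
    (hb : ~ int_lattice R n b) :
  G_ b = closure (convex_hull (I_ b)) /\
  closure (convex_hull (I_ b)) =
    [set x + y | x in convex_hull (I_ b) & y in nonneg R n].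
Proof.
have GI := @G_sub_hull_add R n b.
have clG := @closure_hull_sub_G R n b.
have Icl := @hull_add_sub_closure R n b.
split; apply/seteqP; split=> //.
- exact: subset_trans GI Icl.
- exact: subset_trans clG GI.
Qed.
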